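(* Let $G=(V,\mathcal D,\mathcal B)$ be an acyclic directed mixed graph with Gaussian linear structural equation model $X_V\sim N(0,\Sigma)$, and let $a^*\to b\notin\mathcal D$ be a directed edge whose addition to $G$ gives an acyclic directed mixed graph $G^*$. Suppose that $\lambda_{a^*b}$ (the chosen coefficient of the added edge) and $\sigma(\mathcal D_{bc})$ are identifiable for all $c\in\operatorname{de}(b)\setminus\{b\}$. Then adding the directed edge $a^*\to b$ is equivalent to replacing $X_V$ by $$X_V^*=X_V+\lambda_{a^*b}\,\Sigma(\mathcal D_{bV})\,X_{a^*}.$$ That is, the vector $X_V^*$ so defined is the solution, with the same error vector $\epsilon$, of the structural equations in which the $(a^*,b)$ coefficient is set to $\lambda_{a^*b}$; in particular $X_V^*\sim N(0,\Sigma^* )$, where $\Sigma^*$ is the covariance matrix after addition of $a^*\to b$.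
   Context: An acyclic directed mixed graph (ADMG) $G=(V,\mathcal D,\mathcal B)$ has a finite vertex set $V$, a set $\mathcal D$ of directed edges and a set $\mathcal B$ of bidirected edges, with no loops and no directed cycles. The parameter space $\Theta$ consists of pairs $(\Lambda,\Omega)$ where $\Lambda=(\lambda_{ij})\in\mathbb R^{V\times V}$ has $\lambda_{ij}=0$ unless $i\to j\in\mathcal D$, and $\Omega$ is symmetric positive definite with $\omega_{ij}=0$ unless $i=j$ or $i\leftrightarrow j\in\mathcal B$. The linear structural equation model is $X=\Lambda^TX+\epsilon$ with $\epsilon\sim N(0,\Omega)$, so $X=(I-\Lambda)^{-T}\epsilon$ and $\Sigma=\phi(\Lambda,\Omega)=(I-\Lambda)^{-T}\Omega(I-\Lambda)^{-1}$. Adding the edge $a^*\to b$ with coefficient $\lambda_{a^*b}\in\mathbb R$ (freely chosen, hence known) replaces $\Lambda$ by $\Lambda^*$, equal to $\Lambda$ except that its $(a^*,b)$ entry is $\lambda_{a^*b}$, with the error terms kept the same (''stable error terms''); $\Sigma^*=(I-\Lambda^* )^{-T}\Omega(I-\Lambda^* )^{-1}$. $\operatorname{de}(v)$ is the set of descendants of $v$ in $G$, including $v$. $\mathcal D_{uv}$ is the set of directed paths from $u$ to $v$ in $G$, and $\sigma(\mathcal D_{uv})=\sum_{\tau\in\mathcal D_{uv}}\prod_{x\to y\in\tau}\lambda_{xy}$, with $\sigma(\mathcal D_{bb})=1$ and $\sigma(\mathcal D_{bv})=0$ if $v\notin\operatorname{de}(b)$. $\Sigma(\mathcal D_{bV})=(\sigma(\mathcal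 D_{bv}))_{v\in V}$ is a vector indexed by $V$. A function $f$ on $\Theta$ is identifiable if for Lebesgue-almost all $\theta\in\Theta$ it is constant on the fibre $\phi^{-1}(\phi(\theta))$; the chosen constant $\lambda_{a^*b}$ counts as identifiable. *)

(* Defs.v *)
From HB Require Import structures.
From mathcomp Require Export all_boot all_order all_algebra.
From mathcomp Require Export all_classical all_reals all_analysis.

Set Implicit Arguments.
Unset Strict Implicit.
Unset Printing Implicit Defensive.

Import Order.TTheory GRing.Theory Num.Theory.
Import numFieldNormedType.Exports.

Local Open Scope classical_set_scope.
Local Open Scope ring_scope.

(* A directed mixed graph on the vertex set 'I_n. [dir G i j] is i -> j and
   [bid G i j] is i <-> j; the same two vertices may be joined by both. *)
Record mixed_graph (n : nat) := MixedGraph {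
  dir : rel 'I_n;
  bid : rel 'I_n
}.

(* [cycle (dir G) c] says that c is a closed directed walk (vertex repetitions
   allowed); a directed loop i -> i is the closed walk [:: i]. *)
Definition admg (n : nat) (G : mixed_graph n) : Prop :=
  [/\ symmetric (bid G), irreflexive (bid G) &
      forall c : seq 'I_n, cycle (dir G) c -> c = [::]].

Definition add_dir (n : nat) (G : mixed_graph n) (a b : 'I_n) : mixed_graph n :=
  MixedGraph [rel i j | dir G i j || ((i == a) && (j == b))] (bid G).

Definition de (n : nat) (G : mixed_graph n) (v : 'I_n) : {set 'I_n} :=
  [set w | connect (dir G) v w]%SET.

(* The directed path u -> p_1 -> ... -> p_k = v is encoded by the sequence
   p_1, ..., p_k. As its vertices are distinct, its size is less than n. *)
Definition dpaths (n : nat) (G : mixed_graph n) (u v : 'I_n)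
    : {set n.-bseq 'I_n} :=
  [set p : n.-bseq 'I_n |
    [&& path (dir G) u p, last u p == v & uniq (u :: p)]]%SET.

Definition sigma_paths (R : realType) (n : nat) (G : mixed_graph n)
    (Lam : 'M[R]_n) (u v : 'I_n) : R :=
  \sum_(p in dpaths G u v) \prod_(e <- zip (u :: p) p) Lam e.1 e.2.

Definition Sigma_paths (R : realType) (n : nat) (G : mixed_graph n)
    (Lam : 'M[R]_n) (u : 'I_n) : 'cV[R]_n :=
  \col_v sigma_paths G Lam u v.

Definition posdefmx (R : realType) (n : nat) (A : 'M[R]_n) : Prop :=
  A^T = A /\ forall x : 'cV[R]_n, x != 0 -> 0 < (x^T *m A *m x) 0 0.

Definition Theta (R : realType) (n : nat) (G : mixed_graph n)
    : set ('M[R]_n * 'M[R]_n) :=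
  fun th => [/\ forall i j, ~~ dir G i j -> th.1 i j = 0,
                posdefmx th.2 &
                forall i j, i != j -> ~~ bid G i j -> th.2 i j = 0].

Definition phi (R : realType) (n : nat) (th : 'M[R]_n * 'M[R]_n) : 'M[R]_n :=
  (invmx (1%:M - th.1))^T *m th.2 *m invmx (1%:M - th.1).

(* Lebesgue-null sets of R^I: those which, for every e > 0, are covered by
   countably many boxes of total volume at most e. Only used for nonempty I
   (a box of R^0 has volume 1, so here even set0 would not be null). *)
Definition lebesgue_null (R : realType) (I : finType) (A : set (I -> R)) : Prop :=
  forall e : R, 0 < e ->
    exists lo hi : nat -> I -> R,
      [/\ forall k i, lo k i <= hi k i,
          A `<=` \bigcup_k [set x | forall i, lo k i <= x i <= hi k i] &
          (\sum_(0 <= k <oo) (\prod_i (hi k i - lo k i))%:E <= e%:E)%E].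

(* Theta G lies in a proper linear subspace of pairs of matrices. Its Lebesgue
   measure is that of the free parameters: the lambda_ij with i -> j, the
   omega_ii, and one omega_ij for each unordered pair i <-> j. *)
Definition free_param (n : nat) (G : mixed_graph n) : finType :=
  ({e : 'I_n * 'I_n | dir G e.1 e.2} +
   {e : 'I_n * 'I_n | (e.1 == e.2) || ((e.1 < e.2)%N && bid G e.1 e.2)})%type.

Definition coords (R : realType) (n : nat) (G : mixed_graph n)
    (th : 'M[R]_n * 'M[R]_n) : free_param G -> R :=
  fun c => match c with
           | inl e => th.1 (val e).1 (val e).2
           | inr e => th.2 (val e).1 (val e).2
           end.

Definition almost_all_Theta (R : realType) (n : nat) (G : mixed_graph n)
    (Q : 'M[R]_n * 'M[R]_n -> Prop) : Prop :=
  lebesgue_null (@coords R n G @` [set th | Theta G th /\ ~ Q th]).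

Definition identifiable (R : realType) (n : nat) (G : mixed_graph n)
    (f : 'M[R]_n * 'M[R]_n -> R) : Prop :=
  almost_all_Theta G (fun th =>
    forall th', Theta G th' -> phi th' = phi th -> f th' = f th).

(* N(m, v) on the line, [v] being the variance; [normal_prob] takes the standard
   deviation and is not a point mass when this is 0. *)
Definition normal_law (R : realType) (m v : R)
    (A : set (measurableTypeR R)) : \bar R :=
  if v == 0 then \d_m A else normal_prob m (Num.sqrt v) A.

(* X ~ N(m, S): every linear combination t^T X is distributed as
   N(t^T m, t^T S t). *)
Definition mvnormal (R : realType) (n : nat) (d : measure_display)
    (T : measurableType d) (P : probability T R)
    (X : T -> 'cV[R]_n) (m : 'cV[R]_n) (S : 'M[R]_n) : Prop :=
  [/\ forall i, measurable_fun [set: T] (fun w => X w i 0),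
      S^T = S,
      forall t : 'cV[R]_n, 0 <= (t^T *m S *m t) 0 0 &
      forall (t : 'cV[R]_n) (A : set (measurableTypeR R)), measurable A ->
        P [set w | A ((t^T *m X w) 0 0)] =
        normal_law ((t^T *m m) 0 0) ((t^T *m S *m t) 0 0) A].

Definition structural_eqs (R : realType) (n : nat) (T : Type) (Lam : 'M[R]_n)
    (eps X : T -> 'cV[R]_n) : Prop :=
  forall w, X w = Lam^T *m X w + eps w.

Definition gaussian_lsem (R : realType) (n : nat) (d : measure_display)
    (T : measurableType d) (P : probability T R)
    (th : 'M[R]_n * 'M[R]_n) (eps X : T -> 'cV[R]_n) : Prop :=
  mvnormal P eps 0 th.2 /\ structural_eqs th.1 eps X.

Definition set_coef (R : realType) (n : nat) (Lam : 'M[R]_n) (a b : 'I_n) (l : R)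
    : 'M[R]_n :=
  \matrix_(i, j) (if (i == a) && (j == b) then l else Lam i j).

(* Main.v *)
(* In an acyclic graph every directed walk is a path, so splitting a path at its
   first edge shows that the matrix S of the path sums satisfies
   S = 1 + Lam S, that is, S = (1 - Lam)^-1. Write Lam' = Lam + l E_ab for the
   new coefficients and X' = X + l X_a S^T e_b for the new vector. Then
   (1 - Lam)^T X' = eps + l X_a e_b, and the extra term is l E_ab^T X' because
   X'_a = X_a: a path from b to a would close a cycle with the edge a -> b. Hence
   X' = (1 - Lam')^-T eps is a linear image of a normal vector. *)
From mathcomp Require Import measurable_realfun.
Require Import Defs.

Set Implicit Arguments.
Unset Strict Implicit.
Unset Printing Implicit Defensive.

Import Order.TTheory GRing.Theory Num.Theory.

Local Open Scope ring_scope.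

(** If [u] came back in [p], the part of the walk up to that return would be a nonempty closed
    walk. *)
Lemma acyclic_path_uniq (T : eqType) (e : rel T) (u : T) (p : seq T) :
  (forall c, cycle e c -> c = [::]) -> path e u p -> uniq (u :: p).
Proof.
move=> acyc; elim: p u => [//|k p IHp] u ukp.
have uniq_kp : uniq (k :: p) by apply: IHp; case/andP: ukp.
rewrite cons_uniq uniq_kp andbT; apply/negP => u_kp.
move: ukp; case/path.splitP: u_kp => p1 p2; rewrite cat_path => /andP[up1u _].
by have /= := acyc (u :: p1) up1u.
Qed.

Lemma dpaths_acyclic (n : nat) (G : mixed_graph n) (u v : 'I_n)
    (p : n.-bseq 'I_n) :
  admg G -> (p \in dpaths G u v) = path (dir G) u p && (last u p == v).
Proof.
case=> _ _ acyc; rewrite inE andbA; case: (boolP (path _ _ _)) => //= up.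
by move: (acyclic_path_uniq acyc up) => /= ->; rewrite andbT.
Qed.

Lemma sigma_paths_nodir (R : realType) (n : nat) (G : mixed_graph n)
    (Lam : 'M[R]_n) (u v : 'I_n) :
  admg G -> dir G u v -> sigma_paths G Lam v u = 0.
Proof.
move=> G_admg uv; apply: big1 => p; rewrite dpaths_acyclic //.
move=> /andP[vp /eqP lp].
case: G_admg => _ _ acyc.
by have /acyc : cycle (dir G) (v :: p) by rewrite /= rcons_path vp lp.
Qed.

Lemma sigma_paths_diag (R : realType) (n : nat) (G : mixed_graph n)
    (Lam : 'M[R]_n) (u : 'I_n) : sigma_paths G Lam u u = 1.
Proof.
rewrite /sigma_paths (big_pred1 [bseq of [::]]) => [|p] /=.
  by rewrite big_nil.
rewrite inE -[RHS]val_eqE /=; case: (bseqval p) => [|k q] /=.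
  by rewrite eqxx.
(* A nonempty list ending in [u] makes [u :: p] repeat [u], so only the empty path is left, with
   empty product 1. *)
apply/negbTE/negP => /and4P[_ /eqP lu + _].
by rewrite -lu mem_last.
Qed.

(** Paths are grouped by their second vertex [k]; dropping it leaves a path from [k] to [v]. For
    [u = v] the sum over [k] vanishes, since an edge from [u] to [k] excludes a path back. *)
Lemma sigma_paths_first_step (R : realType) (n : nat) (G : mixed_graph n)
    (Lam : 'M[R]_n) (u v : 'I_n) :
  admg G -> (forall i j, ~~ dir G i j -> Lam i j = 0) ->
  sigma_paths G Lam u v =
  (u == v)%:R + \sum_k Lam u k * sigma_paths G Lam k v.
Proof.
move=> G_admg LamG; case: eqVneq => [<-|neq_uv].
  rewrite sigma_paths_diag big1 ?addr0 // => k _.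
  have [uk|/LamG->] := boolP (dir G u k); last by rewrite mul0r.
  by rewrite sigma_paths_nodir // mulr0.
rewrite add0r {1}/sigma_paths.
(* The default [u] of [head] is reached only by the empty list, which is no path here because
   [u != v]. *)
rewrite (partition_big (fun p : n.-bseq 'I_n => head u p) xpredT) //=.
apply: eq_bigr => k _.
have consK (p : n.-bseq 'I_n) : p \in dpaths G u v -> head u p == k ->
    p = k :: behead p :> seq _.
  rewrite dpaths_acyclic //; case: (bseqval p) => [|x q] /=.
    by rewrite (negbTE neq_uv).
  by move=> _ /eqP ->.
have [uk|nuk] := boolP (dir G u k); last first.
  rewrite LamG // mul0r big_pred0 // => p; apply/negP => /andP[up hp].
  move: (up); rewrite dpaths_acyclic // (consK p up hp) /=.
  by rewrite (negbTE nuk).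
rewrite (reindex_onto (fun p : n.-bseq 'I_n => insub_bseq n (k :: p))
                      (fun p => insub_bseq n (behead p))) /=; last first.
  move=> p /andP[up hp]; apply: val_inj; have Ep := consK p up hp.
  have sz : (size (behead p) <= n)%N.
    by rewrite size_behead (leq_trans (leq_pred _)) ?size_bseq.
  rewrite /= [bseqval (insub_bseq n (behead p))]insubdK //.
  by rewrite insubdK -Ep //; apply: size_bseq.
rewrite mulr_sumr; apply: eq_big => [p|p /andP[/andP[up hp] _]]; last first.
  move: (consK _ up hp); rewrite /insub_bseq val_insubd.
  by case: ifP => //= _ _; rewrite big_cons.
(* When [k :: p] is too long, [insub_bseq] returns the empty list, not a path from [u] to [v]. Nor
   is [p] a path from [k]: [k :: p] would have more than [n] distinct vertices. *)
have [sz|szN] := boolP (size (k :: p) <= n)%N; last first.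
  transitivity false.
    have -> : insub_bseq n (k :: p) = [bseq].
      by apply: val_inj; rewrite /insub_bseq val_insubd (negbTE szN).
    by rewrite inE /= (negbTE neq_uv).
  apply/esym/negP => kp; case/negP: szN; move: kp.
  rewrite inE => /and3P[_ _ /card_uniqP <-].
  by rewrite -[X in (_ <= X)%N]card_ord max_card.
have E : insub_bseq n (k :: p) = k :: p :> seq _ by apply: insubdK.
rewrite !dpaths_acyclic // E /= uk eqxx andbT /=.
suff -> : insub_bseq n p == p by rewrite andbT.
by apply/eqP/val_inj; apply: insubdK; apply: size_bseq.
Qed.

Lemma sub_mul_sigma_paths (R : realType) (n : nat) (G : mixed_graph n)
    (Lam : 'M[R]_n) :
  admg G -> (forall i j, ~~ dir G i j -> Lam i j = 0) ->
  (1%:M - Lam) *m (\matrix_(u, v) sigma_paths G Lam u v) = 1%:M.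
Proof.
move=> G_admg LamG; apply/matrixP => u v.
rewrite mulmxBl mul1mx !mxE sigma_paths_first_step //.
under [X in _ - X]eq_bigr do rewrite mxE.
by rewrite addrK.
Qed.

Lemma unitmx_sub_dir (R : realType) (n : nat) (G : mixed_graph n)
    (Lam : 'M[R]_n) :
  admg G -> (forall i j, ~~ dir G i j -> Lam i j = 0) ->
  1%:M - Lam \in unitmx.
Proof.
move=> G_admg LamG.
by case: (mulmx1_unit (sub_mul_sigma_paths G_admg LamG)).
Qed.

(** The combination of [M X] with weights [t] is that of [X] with weights [M^T t], whose law is
    known. *)
Lemma mvnormal_mulmx (R : realType) (k n : nat) (d : measure_display)
    (T : measurableType d) (P : probability T R) (X : T -> 'cV[R]_n)
    (m : 'cV[R]_n) (S : 'M[R]_n) (M : 'M[R]_(k, n)) :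
  mvnormal P X m S -> mvnormal P (fun w => M *m X w) (M *m m) (M *m S *m M^T).
Proof.
case=> mX symS posS lawX.
have quadE (t : 'cV[R]_k) :
    t^T *m (M *m S *m M^T) *m t = (M^T *m t)^T *m S *m (M^T *m t).
  by rewrite trmx_mul trmxK !mulmxA.
split.
- move=> i; rewrite (_ : (fun _ => _) = fun w => \sum_j M i j * X w j 0).
    by apply: measurable_sum => j; apply: measurable_funM.
  by apply/funext => w; rewrite mxE.
- by rewrite !trmx_mul trmxK symS mulmxA.
- by move=> t; rewrite quadE.
- move=> t A mA; rewrite quadE mulmxA -[t^T *m M]trmxK trmx_mul trmxK -lawX //.
  by congr (P _); apply/seteqP; split => w /=; rewrite mulmxA trmx_mul trmxK.
Qed.

Lemma structural_eqsE (R : realType) (n : nat) (T : Type) (Lam : 'M[R]_n)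
    (eps X : T -> 'cV[R]_n) :
  structural_eqs Lam eps X <-> forall w, (1%:M - Lam)^T *m X w = eps w.
Proof.
split=> sX w.
  by rewrite linearB /= trmx1 mulmxBl mul1mx {1}sX addrC addKr.
by rewrite -(sX w) linearB /= trmx1 mulmxBl mul1mx addrC subrK.
Qed.

Lemma structural_eqs_solve (R : realType) (n : nat) (T : Type) (Lam : 'M[R]_n)
    (eps X : T -> 'cV[R]_n) : 1%:M - Lam \in unitmx ->
  structural_eqs Lam eps X <-> X =1 fun w => (invmx (1%:M - Lam))^T *m eps w.
Proof.
move=> Lam_unit; rewrite structural_eqsE; split=> sX w.
  by rewrite -sX mulmxA -trmx_mul mulmxV // trmx1 mul1mx.
by rewrite sX mulmxA -trmx_mul mulVmx // trmx1 mul1mx.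
Qed.

Lemma set_coefE (R : realType) (n : nat) (Lam : 'M[R]_n) (a b : 'I_n) (l : R) :
  Lam a b = 0 -> set_coef Lam a b l = Lam + l *: delta_mx a b.
Proof.
move=> Lab; apply/matrixP => i j; rewrite !mxE.
case: andP => [[/eqP -> /eqP ->]|_]; first by rewrite Lab add0r mulr1.
by rewrite mulr0 addr0.
Qed.

Theorem theorem4p2 (R : realType) (n : nat) (G : mixed_graph n) (a b : 'I_n)
    (lam_ab : R)
    (G_admg : admg G)
    (ab_notin : ~~ dir G a b)
    (Gstar_admg : admg (add_dir G a b))
    (lam_ident : identifiable G (fun _ : 'M[R]_n * 'M[R]_n => lam_ab))
    (sigma_ident : forall c : 'I_n, c \in (de G b :\ b)%SET ->
       identifiable G (fun th : 'M[R]_n * 'M[R]_n => sigma_paths G th.1 b c))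
    (Lam Om : 'M[R]_n)
    (th_Theta : Theta G (Lam, Om))
    (d : measure_display) (T : measurableType d) (P : probability T R)
    (eps X : T -> 'cV[R]_n)
    (X_model : gaussian_lsem P (Lam, Om) eps X) :
  let Lam_star := set_coef Lam a b lam_ab in
  let X_star := fun w : T =>
    X w + (lam_ab * X w a 0) *: Sigma_paths G Lam b in
  (forall Y : T -> 'cV[R]_n, structural_eqs Lam_star eps Y <-> Y =1 X_star) /\
  mvnormal P X_star 0 (phi (Lam_star, Om)).
Proof.
move=> Lam_star X_star.
have [/= LamG _ _] := th_Theta; have [/= epsN Xeq] := X_model.
have Lam_starG i j : ~~ dir (add_dir G a b) i j -> Lam_star i j = 0.
  by rewrite /= negb_or mxE => /andP[/LamG -> /negbTE ->].
(* The path sums of the enlarged graph, itself acyclic, provide the inverse. *)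
have unit_star := unitmx_sub_dir Gstar_admg Lam_starG.
have Sba : sigma_paths G Lam b a = 0.
  apply: big1 => p; rewrite inE => /and3P[bp /eqP lp _].
  have [_ _ acyc] := Gstar_admg.
  have /acyc // : cycle (dir (add_dir G a b)) (b :: p).
  rewrite /= rcons_path lp /= !eqxx orbT andbT.
  by apply: sub_path bp => i j /= ->.
have SbE : (1%:M - Lam)^T *m Sigma_paths G Lam b = delta_mx b 0.
  (* The vector is row [b] of [S], transposed, so the commuted identity [S (1 - Lam) = 1] is the one
     to transpose. *)
  have := mulmx1C (sub_mul_sigma_paths G_admg LamG).
  set S := \matrix_(u, v) _ => SK.
  have -> : Sigma_paths G Lam b = S^T *m delta_mx b 0.
    by rewrite -colE; apply/matrixP => i j; rewrite !mxE.
  by rewrite mulmxA -trmx_mul SK trmx1 mul1mx.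
have X_starE : structural_eqs Lam_star eps X_star.
  apply/structural_eqsE => w.
  have X_star_a : X_star w a 0 = X w a 0 by rewrite !mxE Sba mulr0 addr0.
  (* As [Lam a b = 0], the new coefficient is a rank-one summand; its transpose subtracts a multiple
     of [e_b] that cancels the surplus from [SbE]. *)
  rewrite /Lam_star set_coefE ?LamG // opprD addrA linearB mulmxBl /=.
  rewrite linearZ /= trmx_delta -scalemxAl.
  have -> : delta_mx b a *m X_star w = X_star w a 0 *: delta_mx b 0.
    apply/matrixP => i j; rewrite !mxE (bigD1 a) //= big1 => [|k ka].
      by rewrite !mxE !ord1 !eqxx andbT addr0 mulrC.
    by rewrite mxE (negbTE ka) andbF mul0r.
  rewrite X_star_a mulmxDr -scalemxAr SbE scalerA addrK.
  by move/structural_eqsE: Xeq.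
have X_star_sol := (structural_eqs_solve eps X_star unit_star).1 X_starE.
split=> [Y|].
  split=> [/(structural_eqs_solve _ _ unit_star) Yeq w|/funext -> //].
  by rewrite Yeq X_star_sol.
(* Mean and covariance are put in the form [M 0] and [M Om M^T], with [M] the transposed inverse of
   [1 - Lam_star]. *)
rewrite (funext X_star_sol) -(mulmx0 _ (invmx (1%:M - Lam_star))^T).
rewrite /phi /= -[X in _ *m _ *m X]trmxK.
exact: mvnormal_mulmx epsN.
Qed.
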